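(* Let $p$ and $q$ be distinct primes and set $\xi=\log q/\log p$. Let $(a,b)\in\mathcal N$ and $\alpha=p^a/q^b$. If $\left(p^{a_1}/q^{b_1},p^{a_2}/q^{b_2},\dots,p^{a_N}/q^{b_N}\right)$ (with $(a_n,b_n)\in\mathcal N$) is a factorization of $\alpha$ which attains the infimum in $m_t(\alpha)$ for some $t>1$, then for every $1\le n\le N$ we have $(a_n,b_n)\in\mathcal G\cap\mathcal U_2(\xi)$ or $(a_n,b_n)\in\mathcal G\cap\mathcal L_1(\xi)$.
   Context: $\mathbb N_0=\{0,1,2,\dots\}$, $\mathcal N=\{(a,b)\in\mathbb N_0^2:(a,b)\neq(0,0)\}$, $\mathcal G=\{(a,b)\in\mathcal N:\gcd(a,b)=1\}$ (convention $\gcd(a,0)=a$; also $a/0=\infty$ for $a\in\mathbb N$). For a positive irrational real $\xi$: $\mathcal U(\xi)=\{(a,b)\in\mathcal N:a>b\xi\}$, $\mathcal L(\xi)=\{(a,b)\in\mathcal N:a<b\xi\}$, $\mathcal U_2(\xi)=\{(a,b)\in\mathcal U(\xi): a/b=\min\{m/n:(m,n)\in\mathcal U(\xi),\ n\le b\}\}$, $\mathcal L_1(\xi)=\{(a,b)\in\mathcal L(\xi): a/b=\max\{m/n:(m,n)\in\mathcal L(\xi),\ m\le a\}\}$. For a nonzero algebraic number $\beta$, $m(\beta)=[\mathbb Q(\beta):\mathbb Q]\,h(\beta)$ where $h$ is the absolute logarithmic Weil height; for a nonzero rational $r/s$ in lowest terms, $m(r/s)=\log\max\{|r|,|s|\}$.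 A product representation of $\alpha$ is a tuple $(\alpha_1,\dots,\alpha_N)$ ($N\ge1$) of nonzero algebraic numbers with $\prod\alpha_n=\alpha$. For $t>0$, $m_t(\alpha)=\inf\{(\sum_{n=1}^N m(\alpha_n)^t)^{1/t}\}$ over all product representations of $\alpha$; a product representation attains the infimum in $m_t(\alpha)$ if $(\sum m(\alpha_n)^t)^{1/t}=m_t(\alpha)$. For a positive rational $\alpha\ne1$, a factorization of $\alpha$ is a product representation $(r_1/s_1,\dots,r_N/s_N)$ with $r_n,s_n\in\mathbb N$, $r_n/s_n\neq1$ for all $n$, and $\gcd(r_m,s_n)=1$ for all $m,n$. For $\alpha=p^a/q^b$ every factorization has the form $(p^{a_1}/q^{b_1},\dots,p^{a_N}/q^{b_N})$ with $\sum a_n=a$, $\sum b_n=b$. *)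

(* Defs.v *)
From mathcomp Require Import all_boot all_order all_algebra all_field finmap.
From mathcomp Require Import all_classical all_reals all_analysis.
Set Implicit Arguments.
Unset Strict Implicit.
Unset Printing Implicit Defensive.
Import Order.TTheory GRing.Theory Num.Theory.
Local Open Scope classical_set_scope.
Local Open Scope ring_scope.

(* [algC] has no embedding into the [realType] R at hand; a real algebraic
   number is sent to R by its Dedekind cut. *)
Definition real_of_algC (R : realType) (x : algC) : R :=
  sup [set (ratr q : R) | q in [set q : rat | ratr q <= x]].

Definition algdegree (b : algC) : nat := (size (minCpoly b)).-1.

(* The roots of the minimal polynomial, that is, the images of b under the
   [Q(b) : Q] embeddings of Q(b) in C. *)
Definition conjugates (b : algC) : seq algC :=
  sval (closed_field_poly_normal (minCpoly b)).

(* The field Q(b) = Q[b]. *)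
Definition Qadjoin (b : algC) : set algC :=
  [set (map_poly ratr f).[b] | f in [set: {poly rat}]].

(* The non-archimedean places of a number field K are represented by their
   valuation rings: these are exactly the valuation rings of K other than K
   itself, namely the localizations of the ring of integers of K at its nonzero
   prime ideals. *)
Definition finite_place (K O : set algC) : Prop :=
  [/\ O `<=` K /\ O <> K,
      O 1,
      forall x y, O x -> O y -> O (x - y),
      forall x y, O x -> O y -> O (x * y) &
      forall x, K x -> x != 0 -> O x \/ O x^-1].

(* The index of xO in O; it is 0 when it is infinite, i.e. when x = 0. *)
Definition ideal_index (O : set algC) (x : algC) : nat :=
  #|` fset_set [set [set y + x * z | z in O] | y in O]|.

(* The normalized absolute value N(P)^(- ord_P x) of the place O, where P is the
   corresponding prime ideal; it is the [K_P : Q_p]-th power of the absolute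
   value which extends the usual p-adic one. *)
Definition place_norm (R : realType) (O : set algC) (x : algC) : R :=
  if x \in O then (ideal_index O x)%:R^-1 else (ideal_index O x^-1)%:R.

(* The absolute logarithmic Weil height, computed in the field Q(b). A complex
   place has local degree 2 and comes from two embeddings in C, so the
   archimedean part is a sum over embeddings. *)
Definition weil_height (R : realType) (b : algC) : R :=
  (\sum_(z <- conjugates b) ln (Num.max 1 (real_of_algC R `|z|))
   + \sum_(O \in finite_place (Qadjoin b)) ln (Num.max 1 (place_norm R O b)))
  / (algdegree b)%:R.

Definition mahler (R : realType) (b : algC) : R :=
  (algdegree b)%:R * weil_height R b.

Definition product_rep (alpha : algC) (s : seq algC) : Prop :=
  [/\ (0 < size s)%N, forall x, x \in s -> x != 0 & \prod_(x <- s) x = alpha].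

Definition mahler_norm (R : realType) (t : R) (s : seq algC) : R :=
  (\sum_(x <- s) mahler R x `^ t) `^ t^-1.

Definition metric_mahler (R : realType) (t : R) (alpha : algC) : R :=
  inf [set mahler_norm t s | s in product_rep alpha].

Definition attains_inf (R : realType) (t : R) (alpha : algC) (s : seq algC) :
    Prop :=
  product_rep alpha s /\ mahler_norm t s = metric_mahler t alpha.

Definition factorization (alpha : rat) (s : seq algC) : Prop :=
  [/\ 0 < alpha, alpha != 1, product_rep (ratr alpha) s &
    exists2 rs : seq (nat * nat), s = [seq x.1%:R / x.2%:R | x <- rs] &
      [/\ forall x, x \in rs -> (0 < x.1)%N /\ (0 < x.2)%N,
          forall x, x \in rs -> x.1%:R / x.2%:R != 1 :> algC &
          forall x y, x \in rs -> y \in rs -> coprime x.1 y.2]].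

Definition calN : set (nat * nat) := [set x | x != (0%N, 0%N)].

Definition calG : set (nat * nat) := [set x | calN x /\ gcdn x.1 x.2 = 1%N].

Definition calU (R : realType) (xi : R) : set (nat * nat) :=
  [set x | calN x /\ x.2%:R * xi < x.1%:R].

Definition calL (R : realType) (xi : R) : set (nat * nat) :=
  [set x | calN x /\ x.1%:R < x.2%:R * xi].

Definition slope (R : realType) (x : nat * nat) : \bar R :=
  if x.2 == 0%N then +oo%E else (x.1%:R / x.2%:R)%:E.

Definition is_min (R : realType) (A : set (\bar R)) (v : \bar R) : Prop :=
  A v /\ lbound A v.

Definition is_max (R : realType) (A : set (\bar R)) (v : \bar R) : Prop :=
  A v /\ ubound A v.

Definition calU2 (R : realType) (xi : R) : set (nat * nat) :=
  [set x | calU xi x /\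
    is_min [set slope R y | y in [set y | calU xi y /\ (y.2 <= x.2)%N]]
      (slope R x)].

Definition calL1 (R : realType) (xi : R) : set (nat * nat) :=
  [set x | calL xi x /\
    is_max [set slope R y | y in [set y | calL xi y /\ (y.1 <= x.1)%N]]
      (slope R x)].

(* Main.v *)
(* The measure of p^a/q^b is max (a log p, b log q), so it equals a log p on
   U(xi) and b log q on L(xi): it is additive on each of these two cones. If
   (a, b) is the sum of two elements of the same cone, replacing p^a/q^b by the
   two corresponding factors strictly decreases the sum of the t-th powers, since
   u^t + v^t < (u + v)^t for t > 1. Such a sum exists when gcd(a, b) > 1, and also
   when some (m, n) in the cone has a slope nearer to xi without exceeding the
   size bound in U_2 or L_1: then (a - m, b - n) stays in the cone, as its slope
   is farther from xi than a/b. *)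
Require Import Defs.
From mathcomp Require Import all_boot all_order all_algebra all_field finmap.
From mathcomp Require Import all_classical all_reals all_analysis.
From mathcomp Require Import ring lra zify.
Set Implicit Arguments.
Unset Strict Implicit.
Unset Printing Implicit Defensive.
Import Order.TTheory GRing.Theory Num.Theory.
Local Open Scope classical_set_scope.
Local Open Scope ring_scope.

(** * The q-adic place of the rationals: the localization of Z at (q) *)

Definition localization (q : nat) : set algC :=
  [set x | exists u : int, exists2 v : nat, coprime q v & x = u%:~R / v%:R].

Section Localization.
Variables (q : nat) (q_pr : prime q).

Lemma coprime_natr_neq0 (v : nat) : coprime q v -> v%:R != 0 :> algC.
Proof.
rewrite pnatr_eq0 => qv; apply/eqP => v0.
by move: qv q_pr; rewrite v0 /coprime gcdn0 => /eqP ->.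
Qed.

Lemma ratr_frac (r : rat) : ratr r = (numq r)%:~R / `|denq r|%N%:R :> algC.
Proof. by rewrite /ratr natr_absz normr_denq. Qed.

Lemma coprime_numq (r : rat) :
  ~~ coprime q `|denq r| -> coprime q `|numq r|.
Proof.
rewrite !prime_coprime// negbK => qd; apply/negP => qn.
have := dvdn_gcd q `|numq r| `|denq r|.
rewrite qn qd (eqP (coprime_num_den r)) dvdn1 => /eqP q1.
by move: q_pr; rewrite q1.
Qed.

Lemma localization_proper : ~ localization q q%:R^-1.
Proof.
have q0 : q%:R != 0 :> algC by rewrite pnatr_eq0 -lt0n prime_gt0.
case=> u [v qv e]; have v0 := coprime_natr_neq0 qv.
have : v%:Z = u * q%:Z.
  apply/eqP; rewrite -(eqr_int algC) intrM; apply/eqP.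
  by apply: (mulIf (invr_neq0 v0)); rewrite mulrAC -e mulfV// mulVf.
move=> /(congr1 absz); rewrite abszM /= => vE.
move: qv; rewrite prime_coprime// => /negP; apply.
by rewrite vE dvdn_mull.
Qed.

Lemma localization_finite_place :
  finite_place (range (ratr : rat -> algC)) (localization q).
Proof.
split.
- split.
    move=> _ [u [v _ ->]]; exists (u%:~R / v%:R) => //.
    by rewrite fmorph_div /= ratr_int ratr_nat.
  move=> /seteqP[_ /(_ q%:R^-1)] h; apply: localization_proper; apply: h.
  by exists q%:R^-1 => //; rewrite fmorphV /= ratr_nat.
- by exists 1, 1%N; rewrite ?coprimen1// divr1.
- move=> _ _ [u1 [v1 qv1 ->]] [u2 [v2 qv2 ->]].
  exists (u1 * v2 - u2 * v1), (v1 * v2)%N; first by rewrite coprimeMr qv1.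
  have := coprime_natr_neq0 qv1; have := coprime_natr_neq0 qv2.
  by move=> *; rewrite natrM intrB !intrM; field; apply/andP.
- move=> _ _ [u1 [v1 qv1 ->]] [u2 [v2 qv2 ->]].
  exists (u1 * u2), (v1 * v2)%N; first by rewrite coprimeMr qv1.
  by rewrite natrM intrM mulrACA -invfM.
- move=> _ [r _ <-] r0.
  have [qd|] := boolP (coprime q `|denq r|).
    by left; exists (numq r), `|denq r|%N; rewrite // ratr_frac.
  move=> qd; right.
  have qn := coprime_numq qd.
  (* Inverting r turns its numerator into the denominator, which must be a natural number, so the
     sign moves to the top. *)
  exists (Num.sg (numq r) * denq r), `|numq r|%N => //.
  have nE : (numq r)%:~R = (Num.sg (numq r))%:~R * `|numq r|%N%:R :> algC.
    by rewrite natr_absz -intrM -numEsg.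
  have s0 : (Num.sg (numq r))%:~R != 0 :> algC.
    by rewrite intr_eq0 sgr_eq0 numq_eq0 -(fmorph_eq0 (ratr : rat -> algC)).
  have := coprime_natr_neq0 qn => n0.
  rewrite /ratr nE intrM invf_div invfM mulrA.
  congr (_ / _).
  rewrite mulrC; congr (_ * _).
  apply: (mulfI s0); rewrite mulfV// -intrM -expr2 sqr_sg numq_eq0.
  by rewrite -(fmorph_eq0 (ratr : rat -> algC)) r0.
Qed.

Lemma finite_placeN (K O : set algC) (x : algC) :
  finite_place K O -> O x -> O (- x).
Proof.
case=> _ O1 OB _ _ Ox; rewrite -[- x]add0r; apply: (OB) => //.
by rewrite -(subrr (1 : algC)); apply: (OB).
Qed.

Lemma finite_placeD (K O : set algC) (x y : algC) :
  finite_place K O -> O x -> O y -> O (x + y).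
Proof.
move=> fO Ox Oy; rewrite -[y]opprK; have [_ _ OB _ _] := fO.
by apply: (OB) => //; apply: (finite_placeN fO).
Qed.

Lemma finite_place_int (K O : set algC) (u : int) : finite_place K O -> O u%:~R.
Proof.
move=> fO; have [_ O1 OB _ _] := fO.
have Onat n : O n%:R.
  elim: n => [|n IH]; first by rewrite mulr0n -(subrr (1 : algC)); apply: (OB).
  by rewrite -natr1; apply: (finite_placeD fO).
case: u => n; first exact: Onat.
by rewrite NegzE intrN; apply: (finite_placeN fO); exact: Onat.
Qed.

(** A place without 1/q contains the inverse of every integer prime to q, hence the whole
    localization. An element with q in its reduced denominator would give 1/q back, so nothing else
    fits in. *)
Lemma finite_place_localizationE (O : set algC) :
  finite_place (range (ratr : rat -> algC)) O -> ~ O q%:R^-1 ->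
  O = localization q.
Proof.
move=> fO Oq; have Oint u := @finite_place_int _ _ u fO.
have [[OK _] _ OB OM OV] := fO.
have q0 : q%:R != 0 :> algC by rewrite pnatr_eq0 -lt0n prime_gt0.
have OD x y := finite_placeD (x := x) (y := y) fO.
(* For v prime to q write 1 = w v + w' q; one of q/v and v/q lies in O,
   which puts 1/v or 1/q in O. *)
have OVn v : coprime q v -> O v%:R^-1.
  move=> qv; have v0 := coprime_natr_neq0 qv.
  have [w [w' bez]] := Bezoutz v q.
  have {}bez : w%:~R * v%:R + w'%:~R * q%:R = 1 :> algC.
    transitivity ((gcdz v q)%:~R : algC); first by rewrite -bez intrD !intrM.
    by rewrite /gcdz /= gcdnC (eqP qv).
  have Kqv : range (ratr : rat -> algC) (q%:R / v%:R).
    by exists (q%:R / v%:R) => //; rewrite fmorph_div /= !ratr_nat.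
  have [Oqv|] := OV _ Kqv (mulf_neq0 q0 (invr_neq0 v0)).
  - have -> : v%:R^-1 = w%:~R + w'%:~R * (q%:R / v%:R) :> algC.
      by rewrite -[LHS]mul1r -[X in X * _]bez mulrDl mulfK// mulrA.
    by apply: (OD) => //; apply: (OM).
  - rewrite invf_div => Ovq; exfalso; apply: Oq.
    have -> : q%:R^-1 = w'%:~R + w%:~R * (v%:R / q%:R) :> algC.
      by rewrite -[LHS]mul1r -[X in X * _]bez mulrDl mulfK// mulrA addrC.
    by apply: (OD) => //; apply: (OM).
apply/seteqP; split => [x Ox|_ [u [v qv ->]]]; last by apply: (OM) => //; exact: OVn.
have [r _ rx] := OK _ Ox; rewrite -rx in Ox *.
have [qd|] := boolP (coprime q `|denq r|).
  by exists (numq r), `|denq r|%N; rewrite // ratr_frac.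
move=> qd; exfalso; apply: Oq.
have qn := coprime_numq qd.
have {}qd : (q %| `|denq r|)%N by move: qd; rewrite prime_coprime// negbK.
have n0 := coprime_natr_neq0 qn.
have d0 : `|denq r|%N%:R != 0 :> algC by rewrite pnatr_eq0 absz_eq0 denq_neq0.
(* With r = n/d and q dividing d, (n/d)(d/q) = n/q; the factor sg(n)/|n| cancels n, and 1/|n| lies
   in [O] because q does not divide n. *)
have -> : q%:R^-1 = ratr r * (`|denq r| %/ q)%N%:R * (Num.sg (numq r))%:~R
                    * `|numq r|%N%:R^-1 :> algC.
  have -> : (`|denq r| %/ q)%N%:R = `|denq r|%N%:R / q%:R :> algC.
    by apply: (mulIf q0); rewrite -natrM divnK// mulfVK.
  have : (numq r)%:~R * (Num.sg (numq r))%:~R = `|numq r|%N%:R :> algC.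
    by rewrite natr_absz -intrM mulrC -abszEsg.
  move=> nE; rewrite ratr_frac; apply: (mulIf n0); rewrite mulfVK// -nE.
  by field; apply/andP.
apply: (OM); last exact: OVn.
by apply: (OM) => //; apply: (OM) => //; exact: (Oint (Posz _)).
Qed.

(** Modulo n the number v is invertible, so i is the residue of u/v. This supplies the coset
    representatives of the index computation. *)
Lemma coprime_residue (u : int) (v n : nat) :
  (0 < n)%N -> coprime n v ->
  exists2 i, (i < n)%N & exists k : int, u - i%:Z * v = n%:Z * k.
Proof.
move=> n0 nv; have [w [w' bez]] := Bezoutz v n.
have {}bez : w * v + w' * n = 1 by rewrite bez /gcdz /= gcdnC (eqP nv).
have n0z : n%:Z != 0 by rewrite eqz_nat -lt0n.
have iE : `|(u * w %% n)%Z|%N%:Z = (u * w %% n)%Z by rewrite gez0_abs ?modz_ge0.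
exists `|(u * w %% n)%Z|%N.
  by rewrite -ltz_nat iE; apply: ltz_pmod; rewrite ltz_nat.
(* Substitute u = u(wv + w'n) and i = uw - n(uw div n) in u - iv, and divide by n. *)
exists (u * w' + (u * w %/ n)%Z * v).
rewrite iE -[X in X - _]mulr1 -[X in _ * X - _]bez.
have /(canRL (addKr _)) -> := esym (divz_eq (u * w) n).
ring.
Qed.

(** As m is a unit of the localization, the ideal is generated by q^b, and 0, ..., q^b - 1 represent
    its cosets. *)
Lemma ideal_index_localization (b m : nat) : coprime q m ->
  ideal_index (localization q) (q%:R ^+ b / m%:R) = (q ^ b)%N.
Proof.
move=> qm; set x := q%:R ^+ b / m%:R.
have m0 := coprime_natr_neq0 qm.
have [_ _ OB OM _] := localization_finite_place.
have fO := localization_finite_place.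
have Oint u : localization q u%:~R := finite_place_int u fO.
have coset y y' w : localization q w -> y = y' + x * w ->
    [set y + x * z | z in localization q] = [set y' + x * z | z in localization q].
  move=> Ow ->; apply/seteqP; split => _ [z Oz <-].
    exists (w + z); first by apply: (finite_placeD fO).
    by rewrite mulrDr addrA.
  exists (z - w); first exact: OB.
  by rewrite mulrBr addrACA subrr addr0.
pose F (i : nat) : set algC := [set i%:R + x * z | z in localization q].
rewrite /ideal_index.
have -> : [set [set y + x * z | z in localization q] | y in localization q]
          = F @` `I_(q ^ b).
  apply/seteqP; split => [_ [_ [u [v qv ->]] <-]|_ [i _ <-]]; last first.
    by exists i%:R => //; exact: (Oint i).
  have v0 := coprime_natr_neq0 qv.
  have [||i lti [k ik]] := @coprime_residue u v (q ^ b)%N.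
  - by rewrite expn_gt0 prime_gt0.
  - exact: coprimeXl.
  (* From u - iv = q^b k one gets i = u/v - x(mk/v). *)
  exists i => //; apply: (coset _ _ (- (m%:R * (k%:~R / v%:R)))).
    apply: (finite_placeN fO); apply: OM; first exact: (Oint m).
    by exists k, v.
  have : (u - i%:Z * v)%:~R = q%:R ^+ b * k%:~R :> algC.
    by rewrite ik intrM -natrX.
  rewrite intrB intrM => /(canRL (subrK _)) ->.
  by rewrite /x; field; rewrite v0.
(* Distinct i, j below q^b give distinct cosets: if i = j + x(u/v), then mv(i - j) = q^b u with mv
   prime to q, so q^b divides i - j. *)
apply: (@card_fset_set (set algC)); apply: inj_card_eq => i j.
rewrite !inE /= => lti ltj Fij.
have : F i i%:R by exists 0; [exact: (Oint 0)|rewrite mulr0 addr0].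
rewrite Fij => -[_ [u [v qv ->]] e].
have v0 := coprime_natr_neq0 qv.
have {e} e : (m * v)%N%:Z * (i%:Z - j%:Z) = (q ^ b)%N%:Z * u.
  apply/eqP; rewrite -(eqr_int algC) !intrM intrB; apply/eqP.
  rewrite -![(Posz _)%:~R]/(_%:R) -e natrM natrX /x.
  by field; rewrite v0.
have : (i%:Z == j%:Z %[mod (q ^ b)%N%:Z])%Z.
  rewrite eqz_mod_dvd -(@Gauss_dvdzr _ (m * v)%N); first by rewrite e dvdz_mulr.
  by rewrite coprimezE /= coprimeXl// coprimeMr qm.
by rewrite !modz_nat eqz_nat !modn_small// => /eqP.
Qed.

End Localization.

(** * The measure of a fraction whose denominator is a prime power *)

Lemma real_of_algC_ratr (R : realType) (r : rat) :
  real_of_algC R (ratr r) = ratr r.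
Proof.
rewrite /real_of_algC.
have ubr : ubound [set (ratr x : R) | x in [set x : rat | ratr x <= ratr r :> algC]]
    (ratr r).
  by move=> _ [x /= xr <-]; move: xr; rewrite !ler_rat.
apply/eqP; rewrite eq_le; apply/andP; split.
  by apply: ge_sup => //; exists (ratr r), r => /=.
apply: ub_le_sup; first by exists (ratr r).
by exists r => /=.
Qed.

Lemma minCpoly_ratr (r : rat) : minCpoly (ratr r) = 'X - (ratr r)%:P.
Proof.
have [p [-> p_mon pP]] := minCpolyP (ratr r).
suff -> : p = 'X - r%:P by rewrite rmorphB /= map_polyX map_polyC.
apply/eqP; rewrite -eqp_monic ?monicXsubC// /eqp -pP.
rewrite rmorphB /= map_polyX map_polyC /= root_XsubC eqxx /=.
have := pP p; rewrite dvdpp /root horner_map fmorph_eq0 => p0.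
by rewrite dvdp_XsubCl.
Qed.

Lemma conjugates_ratr (r : rat) : conjugates (ratr r) = [:: ratr r].
Proof.
rewrite /conjugates; case: closed_field_poly_normal => s /=.
rewrite minCpoly_ratr lead_coefXsubC scale1r => e.
have := size_XsubC (ratr r : algC); rewrite e size_prod_XsubC => -[].
case: s e => [|z []]//= + _; rewrite big_seq1 => /addrI/oppr_inj/polyC_inj.
by move=> ->.
Qed.

Lemma Qadjoin_ratr (r : rat) : Qadjoin (ratr r) = range (ratr : rat -> algC).
Proof.
apply/seteqP; split => _ [x _ <-].
  by exists x.[r]; rewrite // horner_map.
by exists x%:P; rewrite // map_polyC hornerC.
Qed.

(* The only place of Q contributing to the height of m / q ^ b is the q-adic
   one; it turns max (1, m / q ^ b) into max (q ^ b, m). *)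
Lemma mahler_prime_power_denominator (R : realType) (q m b : nat) :
  prime q -> (0 < m)%N -> coprime q m ->
  mahler R (m%:R / q%:R ^+ b) = Num.max (ln m%:R) (ln (q%:R ^+ b)).
Proof.
move=> q_pr m_gt0 qm.
have q0 (F : numFieldType) : 0 < q%:R ^+ b :> F.
  by rewrite exprn_gt0// ltr0n prime_gt0.
have m0 (F : numFieldType) : 0 < m%:R :> F by rewrite ltr0n.
have -> : m%:R / q%:R ^+ b = ratr (m%:R / q%:R ^+ b) :> algC.
  by rewrite fmorph_div rmorphXn /= !ratr_nat.
set r : rat := m%:R / q%:R ^+ b.
have r0 : 0 < r by rewrite divr_gt0 ?m0 ?q0.
have rE (F : numFieldType) : ratr r = m%:R / q%:R ^+ b :> F.
  by rewrite fmorph_div rmorphXn /= !ratr_nat.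
rewrite /mahler /weil_height /algdegree minCpoly_ratr size_XsubC conjugates_ratr.
rewrite big_seq1 divr1 mul1r Qadjoin_ratr -ratr_norm real_of_algC_ratr gtr0_norm//.
(* Integral elements contribute nothing. If the index has its default value 0, its inverse is 0 and
   the maximum is still 1. *)
have norm1 (O : set algC) x : x \in O -> ln (Num.max 1 (place_norm R O x)) = 0.
  move=> Ox; rewrite /place_norm Ox max_l ?ln1//.
  have [->|n0] := eqVneq (ideal_index O x) 0%N; first by rewrite invr0.
  by rewrite invf_le1 ?ltr0n ?ler1n lt0n.
have fO := localization_finite_place q_pr.
(* Every place other than the q-adic one contains 1/q, hence also m/q^b, and so contributes 0. *)
rewrite -(@fsbig_widen _ _ _ _ [set localization q]); first last.
- move=> O /= [] fO' ne; apply: norm1; rewrite inE; apply: contrapT => Or.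
  apply: ne; apply: (finite_place_localizationE q_pr fO') => Oq; apply: Or.
  have [_ O1 _ OM _] := fO'; rewrite rE; apply: (OM).
    exact: (finite_place_int m fO').
  rewrite -exprVn; elim: b {q0 r r0 rE} => [|b IH]; first by rewrite expr0.
  by rewrite exprS; apply: (OM).
- by move=> _ ->.
rewrite fsbig_set1.
have -> : ln (Num.max 1 (place_norm R (localization q) (ratr r)))
          = ln (q%:R ^+ b) :> R.
  have [b0|b0] := posnP b.
    rewrite norm1 ?b0 ?expr0 ?ln1// inE rE b0 expr0 divr1.
    exact: (finite_place_int m fO).
  (* For b > 0 the fraction is not q-integral: m/q^b = u/v would make q divide mv. The local norm is
     then the index of the inverse q^b/m. *)
  rewrite /place_norm ifF; last first.
    apply/negbTE; rewrite notin_setE rE => -[u [v qv e]].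
    have v0 := coprime_natr_neq0 q_pr qv.
    have {e} e : m%:Z * v = u * (q ^ b)%N.
      apply/eqP; rewrite -(eqr_int algC) !intrM; apply/eqP.
      rewrite -![(Posz _)%:~R]/(_%:R) natrX.
      apply: (mulIf (invr_neq0 v0)); rewrite mulfK// mulrAC -e mulfVK//.
      exact: lt0r_neq0 (q0 _).
    have : coprime q (m * v) by rewrite coprimeMr qm.
    move/(congr1 absz): e; rewrite !abszM /= => ->.
    by rewrite prime_coprime// dvdn_mull// dvdn_exp.
  rewrite rE invf_div ideal_index_localization// natrX max_r// exprn_ege1//.
  by rewrite ler1n prime_gt0.
rewrite rE; case: (lerP m%:R (q%:R ^+ b : R)) => mq.
  have r1 : m%:R / q%:R ^+ b <= 1 :> R by rewrite ler_pdivrMr ?q0// mul1r.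
  have lnmq : ln m%:R <= ln (q%:R ^+ b) :> R by rewrite ler_ln ?posrE ?q0 ?m0.
  by rewrite (max_r lnmq) (max_l r1) ln1 add0r.
have r1 : 1 <= m%:R / q%:R ^+ b :> R by rewrite ler_pdivlMr ?q0// mul1r ltW.
have lnmq : ln (q%:R ^+ b) <= ln m%:R :> R by rewrite ler_ln ?posrE ?q0 ?m0// ltW.
by rewrite (max_l lnmq) (max_r r1) ln_div ?posrE ?q0 ?m0// subrK.
Qed.

(** * The exchange argument on product representations *)

(** Write u^t = u u^(t-1) < u (u+v)^(t-1), likewise for v, and add. *)
Lemma powR_superadd (R : realType) (t u v : R) :
  1 < t -> 0 < u -> 0 < v -> u `^ t + v `^ t < (u + v) `^ t.
Proof.
move=> t1 u0 v0.
have t0 : 0 < t by rewrite (lt_trans ltr01).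
have uv0 : 0 < u + v by apply: addr_gt0.
have tB1 : 0 < t - 1 by rewrite subr_gt0.
rewrite -(mulr_powRB1 (ltW u0) t0) -(mulr_powRB1 (ltW v0) t0).
rewrite -(mulr_powRB1 (ltW uv0) t0) mulrDl.
apply: ltrD; rewrite ltr_pM2l//; apply: gt0_ltr_powR => //;
  rewrite ?nnegrE ?ltW// ?ltrDl ?ltrDr//.
Qed.

(** Replacing x by the pair y, z keeps the product. If the measures added up, the sum of t-th powers
    would strictly drop by [powR_superadd], below the infimum. *)
Lemma attains_inf_split (R : realType) (t : R) (alpha x y z : algC) (s : seq algC) :
  1 < t -> attains_inf t alpha s -> x \in s -> x = y * z ->
  0 < mahler R y -> 0 < mahler R z -> mahler R x <> mahler R y + mahler R z.
Proof.
move=> t1 [[s0 s_neq0 prod_s] s_inf] xs xyz y0 z0 xE.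
have t0 : 0 < t by rewrite (lt_trans ltr01).
pose s' := [:: y, z & rem x s].
have s'_rep : product_rep alpha s'.
  split=> //.
    have := s_neq0 _ xs; rewrite xyz mulf_eq0 negb_or => /andP[y_neq0 z_neq0] w.
    by rewrite !inE => /or3P[/eqP->|/eqP->|/mem_rem/s_neq0].
  by rewrite -prod_s (perm_big _ (perm_to_rem xs)) !big_cons mulrA -xyz.
have : metric_mahler t alpha <= mahler_norm t s'.
  by apply: ge_inf; [exists 0 => _ [u _ <-]; exact: powR_ge0|exists s'].
rewrite -s_inf leNgt => /negP; apply; apply: gt0_ltr_powR.
- by rewrite invr_gt0.
- by rewrite nnegrE sumr_ge0// => *; exact: powR_ge0.
- by rewrite nnegrE sumr_ge0// => *; exact: powR_ge0.
rewrite (perm_big _ (perm_to_rem xs)) !big_cons addrA ltrD2r xE.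
exact: powR_superadd.
Qed.

(** * Decomposing lattice points inside the two cones *)

Lemma calUP (R : realType) (xi : R) (x : nat * nat) :
  calU xi x <-> x.2%:R * xi < x.1%:R.
Proof.
split=> [[]//|xU]; split=> //; apply/eqP => x0.
by move: xU; rewrite x0 mul0r ltxx.
Qed.

Lemma calLP (R : realType) (xi : R) (x : nat * nat) :
  calL xi x <-> x.1%:R < x.2%:R * xi.
Proof.
split=> [[]//|xL]; split=> //; apply/eqP => x0.
by move: xL; rewrite x0 mul0r ltxx.
Qed.

(** Cross-multiplication survives infinite slopes: if y.2 = 0 both sides are false; if only x.2 = 0
    both are true, since [calN x] then forces x.1 > 0. *)
Lemma slope_lt (R : realType) (x y : nat * nat) : calN x ->
  (slope R y < slope R x)%E = (y.1 * x.2 < x.1 * y.2)%N.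
Proof.
case: x y => [a b] [m n] /eqP xN; rewrite /slope /=.
have [->|n0] := eqVneq n 0%N; first by rewrite muln0 ltn0 ltNge leey.
have [b0|b0] := eqVneq b 0%N.
  rewrite b0 muln0 ltry muln_gt0 !lt0n n0 andbT; apply/esym/eqP => a0.
  by apply: xN; rewrite a0 b0.
rewrite lte_fin ltr_pdivrMr ?ltr0n ?lt0n// mulrAC ltr_pdivlMr ?ltr0n ?lt0n//.
by rewrite -!natrM ltr_nat.
Qed.

(** Dividing x by g = gcd gives y with x = y + (g - 1)y; both summands lie on the ray of x, hence in
    its cone. *)
Lemma gcdn_split (x : nat * nat) : calN x -> gcdn x.1 x.2 <> 1%N ->
  exists y d, (0 < d)%N /\ x = (y.1 + d * y.1, y.2 + d * y.2)%N.
Proof.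
move=> xN; set g := gcdn x.1 x.2 => g1.
have g0 : (0 < g)%N.
  rewrite lt0n; apply/eqP => g0; move/eqP: xN; apply.
  have := dvdn_gcdl x.1 x.2; have := dvdn_gcdr x.1 x.2.
  by rewrite -/g g0 !dvd0n; case: (x) => a b /= /eqP-> /eqP->.
exists (x.1 %/ g, x.2 %/ g)%N, g.-1; split => /=.
  by case: g g0 g1 => [|[]].
rewrite -!mulSn prednK// mulnC divnK ?dvdn_gcdl// mulnC divnK ?dvdn_gcdr//.
by case: (x).
Qed.

Lemma calU_split (R : realType) (xi : R) (x : nat * nat) :
  calU xi x -> ~ (calG `&` calU2 xi) x ->
  exists y z, [/\ calU xi y, calU xi z & x = (y.1 + z.1, y.2 + z.2)%N].
Proof.
move=> xU /not_andP[xG|xU2].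
  have [|y [d [d0 xE]]] := gcdn_split xU.1.
    by move=> g1; apply: xG; split=> //; exact: xU.1.
  have yU : calU xi y.
    apply/calUP; move/calUP: xU; rewrite xE /= -!mulSn !natrM -mulrA ltr_pM2l//.
  exists y, (d * y.1, d * y.2)%N; split => //.
  by apply/calUP; rewrite /= !natrM -mulrA ltr_pM2l ?ltr0n//; apply/calUP.
have [y [yU le_yx lt_yx]] : exists y, [/\ calU xi y, (y.2 <= x.2)%N &
    (slope R y < slope R x)%E].
  apply: contrapT => noy; apply: xU2; split=> //; split; first by exists x.
  move=> _ [y [yU yx] <-]; rewrite leNgt; apply/negP => lt_yx.
  by apply: noy; exists y.
move: lt_yx; rewrite (slope_lt _ _ xU.1) => lt_yx.
(* If x.2 were 0, then y.2 = 0 too and [lt_yx] would read 0 < 0. *)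
have x2_gt0 : (0 < x.2)%N by move: lt_yx le_yx; case: (y.2) => [|n]; lia.
have y1x1 : (y.1 < x.1)%N by nia.
exists y, (x.1 - y.1, x.2 - y.2)%N; split=> //; last first.
  by rewrite /= (subnKC (ltnW y1x1)) (subnKC le_yx); case: (x).
apply/calUP; rewrite /= !natrB ?(ltnW y1x1)//.
move/calUP: xU => xU.
have x2R : 0 < x.2%:R :> R by rewrite ltr0n.
(* After scaling by x.2, compare both sides with (x.2 - y.2) x.1. The first bound is weak because
   y.2 = x.2 is allowed; the second is [lt_yx]. *)
rewrite -(ltr_pM2l x2R) mulrCA.
apply: (@le_lt_trans _ _ ((x.2%:R - y.2%:R) * x.1%:R)).
  by apply: ler_wpM2l; [rewrite subr_ge0 ler_nat|exact: ltW].
by move: lt_yx; rewrite -(ltr_nat R) !natrM; lra.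
Qed.

Lemma calL_split (R : realType) (xi : R) (x : nat * nat) :
  calL xi x -> ~ (calG `&` calL1 xi) x ->
  exists y z, [/\ calL xi y, calL xi z & x = (y.1 + z.1, y.2 + z.2)%N].
Proof.
move=> xL /not_andP[xG|xL1].
  have [|y [d [d0 xE]]] := gcdn_split xL.1.
    by move=> g1; apply: xG; split=> //; exact: xL.1.
  have yL : calL xi y.
    apply/calLP; move/calLP: xL; rewrite xE /= -!mulSn !natrM -mulrA ltr_pM2l//.
  exists y, (d * y.1, d * y.2)%N; split => //.
  by apply/calLP; rewrite /= !natrM -mulrA ltr_pM2l ?ltr0n//; apply/calLP.
have [y [yL le_yx lt_xy]] : exists y, [/\ calL xi y, (y.1 <= x.1)%N &
    (slope R x < slope R y)%E].
  apply: contrapT => noy; apply: xL1; split=> //; split; first by exists x.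
  move=> _ [y [yL yx] <-]; rewrite leNgt; apply/negP => lt_xy.
  by apply: noy; exists y.
move: lt_xy; rewrite (slope_lt _ _ yL.1) => lt_xy.
(* Here x.1 y.2 < y.1 x.2 <= x.1 x.2, by the size bound on first coordinates. *)
have y2x2 : (y.2 < x.2)%N by nia.
exists y, (x.1 - y.1, x.2 - y.2)%N; split=> //; last first.
  by rewrite /= (subnKC le_yx) (subnKC (ltnW y2x2)); case: (x).
apply/calLP; rewrite /= !natrB ?(ltnW y2x2)//.
move/calLP: xL => xL.
have x2R : 0 < x.2%:R :> R by rewrite ltr0n; case: (x.2) y2x2.
rewrite -(ltr_pM2l x2R) [ltRHS]mulrCA.
apply: (@lt_le_trans _ _ ((x.2%:R - y.2%:R) * x.1%:R)).
  by move: lt_xy; rewrite -(ltr_nat R) !natrM; lra.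
by apply: ler_wpM2l; [rewrite subr_ge0 ler_nat ltnW|exact: ltW].
Qed.

(** * Applying the exchange argument to the factors of an optimal factorization *)

Theorem theorem3p1 (R : realType) (p q : nat) (hp : prime p) (hq : prime q)
    (hpq : p <> q) (a b : nat) (hab : calN (a, b)) (s : seq (nat * nat))
    (hs : forall x, x \in s -> calN x) (t : R) (ht : 1 < t) :
  let xi : R := ln q%:R / ln p%:R in
  let alpha : rat := p%:R ^+ a / q%:R ^+ b in
  let rep : seq algC := [seq p%:R ^+ x.1 / q%:R ^+ x.2 | x <- s] in
  factorization alpha rep ->
  attains_inf t (ratr alpha) rep ->
  forall x, x \in s -> (calG `&` calU2 xi) x \/ (calG `&` calL1 xi) x.
Proof.
move=> xi alpha rep _ rep_inf x xs.
have p1 : 1 < p%:R :> R by rewrite ltr1n prime_gt1.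
have q1 : 1 < q%:R :> R by rewrite ltr1n prime_gt1.
have lnp : 0 < ln p%:R :> R by rewrite ln_gt0.
have lnq : 0 < ln q%:R :> R by rewrite ln_gt0.
have pq : coprime p q by rewrite prime_coprime// dvdn_prime2//; apply/eqP.
(* Since log q = xi log p, factoring out log p leaves a maximum whose two entries are compared by
   the cones. *)
have mahlerE (y : nat * nat) : mahler R (p%:R ^+ y.1 / q%:R ^+ y.2)
    = ln p%:R * Num.max y.1%:R (y.2%:R * xi).
  rewrite -natrX mahler_prime_power_denominator ?expn_gt0 ?prime_gt0//; last first.
    by rewrite coprimeXr// coprime_sym.
  rewrite natrX !lnXn ?ltr0n ?prime_gt0// maxr_pMr ?ltW// mulr_natr.
  by rewrite mulrCA /xi [ln p%:R * _]mulrC divfK ?gt_eqF// mulr_natl.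
have mahlerU y : calU xi y -> mahler R (p%:R ^+ y.1 / q%:R ^+ y.2) = ln p%:R * y.1%:R.
  by move=> /calUP yU; rewrite mahlerE max_l// ltW.
have mahlerL y : calL xi y ->
    mahler R (p%:R ^+ y.1 / q%:R ^+ y.2) = ln p%:R * (y.2%:R * xi).
  by move=> /calLP yL; rewrite mahlerE max_r// ltW.
have xi0 : 0 < xi by rewrite divr_gt0.
have mahler_gt0 y : calN y -> 0 < mahler R (p%:R ^+ y.1 / q%:R ^+ y.2).
  case: y => [[|m] n] yN; rewrite mahlerE mulr_gt0// lt_max ?ltr0n//=.
  by case: n yN => [/eqP|n _]//; rewrite mulr_gt0 ?orbT.
(* A decomposition of the exponent vector factors the corresponding entry, so optimality forbids
   additivity of the measure. *)
have no_split y z : calN y -> calN z -> x = (y.1 + z.1, y.2 + z.2)%N ->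
    mahler R (p%:R ^+ x.1 / q%:R ^+ x.2)
    <> mahler R (p%:R ^+ y.1 / q%:R ^+ y.2) + mahler R (p%:R ^+ z.1 / q%:R ^+ z.2).
  move=> yN zN xyz; apply: (attains_inf_split ht rep_inf) => //.
  - exact: (map_f (fun x => p%:R ^+ x.1 / q%:R ^+ x.2) xs).
  - by rewrite xyz /= !exprD invfM mulrACA.
  - exact: mahler_gt0.
  - exact: mahler_gt0.
have [xU|xL|xi_eq] := ltgtP (x.2%:R * xi) x.1%:R.
- have {}xU : calU xi x by apply/calUP.
  left; apply: contrapT => /(calU_split xU)[y [z [yU zU xyz]]].
  apply: (no_split y z) => //; [exact: yU.1|exact: zU.1|].
  by rewrite !mahlerU// xyz natrD mulrDr.
- have {}xL : calL xi x by apply/calLP.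
  right; apply: contrapT => /(calL_split xL)[y [z [yL zL xyz]]].
  apply: (no_split y z) => //; [exact: yL.1|exact: zL.1|].
  by rewrite !mahlerL// xyz natrD mulrDl mulrDr.
(* On the boundary ray, q^x.2 = p^x.1; these powers are coprime, so both equal 1 and x = (0, 0),
   contrary to [hs]. *)
- have : ln (q%:R ^+ x.2) = ln (p%:R ^+ x.1) :> R.
    rewrite !lnXn ?ltr0n ?prime_gt0// -[LHS]mulr_natl -[RHS]mulr_natl -xi_eq.
    by rewrite -mulrA /xi divfK// gt_eqF.
  rewrite -!natrX => /ln_inj; rewrite !posrE !ltr0n !expn_gt0 !prime_gt0//.
  move=> /(_ isT isT)/eqP; rewrite eqr_nat => /eqP xE; exfalso.
  have : coprime (p ^ x.1) (q ^ x.2) by rewrite coprimeXl// coprimeXr.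
  rewrite xE /coprime gcdnn => /eqP p1E.
  have x1 : x.1 = 0%N by apply: (expnI (prime_gt1 hp)); rewrite expn0.
  have x2 : x.2 = 0%N by apply: (expnI (prime_gt1 hq)); rewrite expn0 xE.
  by move/eqP: (hs _ xs); case: (x) x1 x2 => ? ? /= -> ->.
Qed.
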